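(* Let $k$ be a knot in $S^3$ with knot group $G$ and Alexander polynomial $\Delta(t)$, and let $K=G'$ be the commutator subgroup of $G$. If $\Delta(t)$ has a non-constant factor $f(t)$ which is monic in $t$ and in $1/t$, then $K$ has a homomorphism onto $\mathbb{Z}$, and hence $K$ has subgroups of every finite index.
   Context: A knot in $S^3$ is a piecewise linear embedding of $S^1$ into $S^3$; its knot group $G$ is the fundamental group of its complement, and $G/G'\cong\mathbb{Z}$. The abelianisation $H_1(G';\mathbb{Z})$ is a finitely presented module over $\mathbb{Z}[t^{\pm1}]$, where $t$ acts by conjugation by an element of $G$ mapping to a generator of $G/G'$. The Alexander polynomial $\Delta(t)\in\mathbb{Z}[t^{\pm1}]$ is the highest common factor of the $m\times m$ minors of an $m\times n$ presentation matrix ($m$ generators, $m\le n$) of this module, defined up to multiplication by units $\pm t^k$. Factors are taken in $\mathbb{Z}[t^{\pm1}]$. The degree of a nonzero Laurent polynomial is the highest exponent of $t$ occurring minus the lowest, and non-constant means of positive degree. A Laurent polynomial is monic in $t$ and in $1/t$ (equivalently ''monic at both ends'') if the coefficients of its highest and of its lowest occurring powers of $t$ are both $\pm1$. *)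

(* Defs.v *)
From HB Require Import structures.
From mathcomp Require Import all_boot all_order all_algebra.
From mathcomp Require Import fraction.
From mathcomp Require Import ring lra zify.
From mathcomp Require Import all_classical all_reals all_analysis.
From mathcomp Require Import homotopy.

Set Implicit Arguments.
Unset Strict Implicit.
Unset Printing Implicit Defensive.

Import Order.TTheory GRing.Theory Num.Theory.
Import numFieldNormedType.Exports.

Local Open Scope classical_set_scope.
Local Open Scope ring_scope.
Local Open Scope quotient_scope.

Section UnitInterval.
Variable R : realType.

Definition unit_interval : Type := set_type (`[0, 1]%classic : set R).
HB.instance Definition _ := Topological.copy unit_interval
  (set_type (`[0, 1]%classic : set R)).

Definition uval (s : unit_interval) : R := set_val s.

Lemma clamp_subproof (r : R) : Num.min 1 (Num.max 0 r) \in (`[0, 1]%classic : set R).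
Proof. by rewrite inE /= in_itv /= le_min ler01 le_max lexx ge_min lexx. Qed.

Definition clamp (r : R) : unit_interval := SigSub (clamp_subproof r).

Lemma uval_ge0 s : 0 <= uval s.
Proof. by case: s => s; rewrite /uval set_valE /= inE /= in_itv /= => /andP[]. Qed.

Lemma uval_le1 s : uval s <= 1.
Proof. by case: s => s; rewrite /uval set_valE /= inE /= in_itv /= => /andP[]. Qed.

Lemma uval_inj : injective uval.
Proof. by move=> s t st; apply: val_inj. Qed.

Lemma clampE r : uval (clamp r) = Num.min 1 (Num.max 0 r).
Proof. by []. Qed.

Lemma clampK s : clamp (uval s) = s.
Proof.
apply: uval_inj; rewrite clampE.
by rewrite max_r ?uval_ge0 // min_r ?uval_le1.
Qed.

Lemma clamp_id r : 0 <= r <= 1 -> uval (clamp r) = r.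
Proof. by case/andP => r0 r1; rewrite clampE max_r // min_r. Qed.

Lemma clamp01_neq : clamp 0 != clamp 1.
Proof.
apply/eqP => /(congr1 uval); rewrite !clamp_id ?lexx ?ler01 // => /eqP.
by rewrite eq_sym oner_eq0.
Qed.

HB.instance Definition _ := isBiPointed.Build unit_interval clamp01_neq.

Lemma uval0 : uval zero = 0. Proof. by rewrite clamp_id // lexx ler01. Qed.
Lemma uval1 : uval one = 1. Proof. by rewrite clamp_id // lexx ler01. Qed.

Lemma uval_continuous : continuous uval.
Proof. exact: initial_continuous. Qed.

Lemma clamp_continuous : continuous clamp.
Proof.
apply: continuous_comp_initial => x.
apply: continuous_min; first exact: cvg_cst.
by apply: continuous_max; [exact: cvg_cst | exact: cvg_id].
Qed.

Lemma paste_continuous (T Y : topologicalType) (c : T -> R) (F G : T -> Y) :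
  continuous c -> continuous F -> continuous G ->
  (forall t, c t = 2^-1 -> F t = G t) ->
  continuous (fun t => if c t <= 2^-1 then F t else G t).
Proof.
move=> cc cF cG FG; apply/continuous_subspace_setT.
have -> : setT = (c @^-1` [set x | x <= 2^-1]) `|` (c @^-1` [set x | 2^-1 <= x]).
  by apply/seteqP; split=> // t _ /=; case: (lerP (c t) 2^-1) => [|/ltW]; [left|right].
apply: withinU_continuous.
- by apply: closed_comp => [x _|]; [exact: cc | exact: closed_le].
- by apply: closed_comp => [x _|]; [exact: cc | exact: closed_ge].
- apply: (@subspace_eq_continuous _ _ _ F); last exact: continuous_subspaceT.
  by move=> t; rewrite inE /from_subspace /= => ->.
- apply: (@subspace_eq_continuous _ _ _ G); last exact: continuous_subspaceT.
  move=> t; rewrite inE /from_subspace /= => ht; case: ifPn => // ht'; rewrite FG //.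
  by apply/eqP; rewrite eq_le ht ht'.
Qed.

End UnitInterval.

Lemma pair_cont (T U V : topologicalType) (f : T -> U) (g : T -> V) :
  continuous f -> continuous g -> continuous (fun t => (f t, g t)).
Proof.
move=> cf cg t.
exact: (@cvg_pair _ _ _ _ (nbhs (f t)) (nbhs (g t)) _ _ _ f g (cf t) (cg t)).
Qed.

Lemma comp_cont (T U V : topologicalType) (f : T -> U) (g : U -> V) :
  continuous f -> continuous g -> continuous (fun t => g (f t)).
Proof. by move=> cf cg t; apply: (@continuous_comp _ _ _ f g); [exact: cf|exact: cg]. Qed.

Lemma fst_cont (T U : topologicalType) : continuous (@fst T U).
Proof. by move=> p; exact: cvg_fst. Qed.

Lemma snd_cont (T U : topologicalType) : continuous (@snd T U).
Proof. by move=> p; exact: cvg_snd. Qed.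

Section FundamentalGroup.
Variables (R : realType) (X : topologicalType) (x0 : X).
Local Notation I := (unit_interval R).

Definition loop : Type := {path I from x0 to x0 in X}.
HB.instance Definition _ := Choice.on loop.

Implicit Types f g h : loop.

Lemma loop_eq f g : (f : I -> X) =1 g -> f = g.
Proof. by move/path_eqP. Qed.

Lemma loop0 f : f zero = x0. Proof. exact: path_zero. Qed.
Lemma loop1 f : f one = x0. Proof. exact: path_one. Qed.
Lemma loop_cont f : continuous (f : I -> X). Proof. exact: cts_fun. Qed.

(* Homotopy of loops relative to the base point. *)
Definition homotopy f g (H : I * I -> X) : Prop :=
  [/\ continuous H,
      forall s, H (s, zero) = f s,
      forall s, H (s, one) = g s &
      forall u, H (zero, u) = x0 /\ H (one, u) = x0].

Definition homotopic : rel loop := fun f g => `[< exists H, homotopy f g H >].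

Lemma homotopicI f g (H : R * R -> X) : continuous H ->
  (forall s : I, H (uval s, 0) = f s) -> (forall s : I, H (uval s, 1) = g s) ->
  (forall u : I, H (0, uval u) = x0 /\ H (1, uval u) = x0) -> homotopic f g.
Proof.
move=> cH H0 H1 Hx; apply/asboolP; exists (fun p => H (uval p.1, uval p.2)).
split=> [p|s|s|u] /=; rewrite ?uval0 ?uval1 //.
apply: (comp_cont _ cH); apply: pair_cont.
  by apply: comp_cont; [exact: fst_cont | exact: uval_continuous].
by apply: comp_cont; [exact: snd_cont | exact: uval_continuous].
Qed.

Lemma homotopicE f g : homotopic f g -> exists H : R * R -> X,
  [/\ continuous H, forall s, H (s, 0) = f (clamp s), forall s, H (s, 1) = g (clamp s)
    & forall u, H (0, u) = x0 /\ H (1, u) = x0].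
Proof.
move=> /asboolP[H [cH H0 H1 Hx]]; exists (fun p => H (clamp p.1, clamp p.2)).
split=> [p|s|s|u] //=.
apply: (comp_cont _ cH); apply: pair_cont.
  by apply: comp_cont; [exact: fst_cont | exact: clamp_continuous].
by apply: comp_cont; [exact: snd_cont | exact: clamp_continuous].
Qed.

Lemma loop_clamp_comp f (T : topologicalType) (phi : T -> R) :
  continuous phi -> continuous (fun t => f (clamp (phi t))).
Proof.
move=> cphi; apply: comp_cont; last exact: loop_cont.
by apply: comp_cont; [exact: cphi | exact: clamp_continuous].
Qed.

Lemma lin_cont (a b : R) : continuous (fun r : R => a * r + b).
Proof.
move=> r; apply: cvgD; last exact: cvg_cst.
by apply: cvgM; [exact: cvg_cst | exact: cvg_id].
Qed.

Lemma homotopic_reparam f g h (phi psi : R -> R) :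
  continuous phi -> continuous psi ->
  (forall s : I, g s = f (clamp (phi (uval s)))) ->
  (forall s : I, h s = f (clamp (psi (uval s)))) ->
  phi 0 = psi 0 -> phi 1 = psi 1 -> homotopic g h.
Proof.
move=> cphi cpsi gE hE e0 e1.
pose F (p : R * R) := phi p.1 + p.2 * (psi p.1 - phi p.1).
have cF : continuous F.
  have c1 chi : continuous chi -> continuous (fun p : R * R => chi p.1 : R).
    by move=> c; apply: comp_cont; [exact: fst_cont | exact: c].
  move=> p; apply: cvgD; first exact: c1.
  apply: cvgM; first exact: snd_cont.
  by apply: cvgB; exact: c1.
apply: (@homotopicI _ _ (fun p => f (clamp (F p)))).
- exact: loop_clamp_comp.
- by move=> s; rewrite /F /= mul0r addr0 gE.
- by move=> s; rewrite /F /= mul1r addrC subrK hE.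
- move=> u; rewrite /F /= e0 e1 !subrr !mulr0 !addr0 -e0 -e1.
  by rewrite -{1}uval0 -gE loop0 -{1}(uval1 R) -gE loop1.
Qed.

Lemma homotopic_refl : reflexive homotopic.
Proof.
have id_cont : continuous (id : R -> R) by move=> r; exact: cvg_id.
move=> f; apply: (homotopic_reparam id_cont id_cont (f := f)) => // s;
  by rewrite /= clampK.
Qed.

Lemma homotopic_symP f g : homotopic f g -> homotopic g f.
Proof.
move=> /homotopicE[H [cH H0 H1 Hx]].
apply: (@homotopicI _ _ (fun p => H (p.1, 1 - p.2))).
- apply: (comp_cont _ cH); apply: pair_cont; first exact: fst_cont.
  by move=> p; apply: cvgB; [exact: cvg_cst | exact: snd_cont].
- by move=> s; rewrite /= subr0 H1 clampK.
- by move=> s; rewrite /= subrr H0 clampK.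
- by move=> u; exact: Hx.
Qed.

Lemma homotopic_sym : symmetric homotopic.
Proof. by move=> f g; apply/idP/idP; exact: homotopic_symP. Qed.

Lemma homotopic_trans : transitive homotopic.
Proof.
move=> g f h /homotopicE[H [cH H0 H1 Hx]] /homotopicE[K [cK K0 K1 Kx]].
apply: (@homotopicI _ _ (fun p => if p.2 <= 2^-1 then H (p.1, 2 * p.2)
  else K (p.1, 2 * p.2 - 1))).
- apply: paste_continuous.
  + by move=> p; exact: cvg_snd.
  + apply: (comp_cont _ cH); apply: pair_cont; first exact: fst_cont.
    by move=> p; apply: cvgM; [exact: cvg_cst | exact: snd_cont].
  + apply: (comp_cont _ cK); apply: pair_cont; first exact: fst_cont.
    move=> p; apply: cvgB; last exact: cvg_cst.
    by apply: cvgM; [exact: cvg_cst | exact: snd_cont].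
  + by move=> [s u] /= ->; rewrite mulfV // subrr H1 K0.
- by move=> s /=; rewrite invr_ge0 ler0n mulr0 H0 clampK.
- move=> s /=; rewrite ifF; last by apply/negbTE; rewrite -ltNge; lra.
  by rewrite (_ : 2 * 1 - 1 = 1) ?K1 ?clampK //; lra.
- by move=> u /=; case: ifP => _; [have [-> ->] := Hx (2 * uval u)
    | have [-> ->] := Kx (2 * uval u - 1)].
Qed.

Definition loop_equiv := EquivRel _ homotopic_refl homotopic_sym homotopic_trans.

Definition concat_fun f g (s : I) : X :=
  if uval s <= 2^-1 then f (clamp (2 * uval s)) else g (clamp (2 * uval s - 1)).

Let concatR f g (r : R) : X :=
  if r <= 2^-1 then f (clamp (2 * r)) else g (clamp (2 * r - 1)).

Let clamp0 : clamp 0 = zero :> I. Proof. by rewrite -(uval0 R) clampK. Qed.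
Let clamp1 : clamp 1 = one :> I. Proof. by rewrite -(uval1 R) clampK. Qed.

Let concatR_cont f g : continuous (concatR f g).
Proof.
apply: paste_continuous.
- by move=> p; exact: cvg_id.
- apply: loop_clamp_comp => r; apply: cvgM; [exact: cvg_cst | exact: cvg_id].
- by apply: loop_clamp_comp; exact: lin_cont.
- by move=> r ->; rewrite mulfV // subrr clamp1 clamp0 loop0 loop1.
Qed.

Lemma concat_continuous f g : continuous (concat_fun f g).
Proof.
apply: (@comp_cont _ _ _ (@uval R) (concatR f g)); first exact: uval_continuous.
exact: concatR_cont.
Qed.

Lemma concat0 f g : concat_fun f g zero = x0.
Proof. by rewrite /concat_fun uval0 invr_ge0 ler0n mulr0 clamp0 loop0. Qed.

Lemma concat1 f g : concat_fun f g one = x0.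
Proof.
rewrite /concat_fun uval1 ifF; last by apply/negbTE; rewrite -ltNge; lra.
by rewrite (_ : 2 * 1 - 1 = 1 :> R) ?clamp1 ?loop1 //; lra.
Qed.

Definition concat f g : loop :=
  mk_path (@concat_continuous f g) (concat0 f g) (concat1 f g).

Lemma concatE f g (s : I) : concat f g s = concat_fun f g s. Proof. by []. Qed.

Definition rev_fun f (s : I) : X := f (clamp (1 - uval s)).

Lemma rev_continuous f : continuous (rev_fun f).
Proof.
apply: (@loop_clamp_comp f _ (fun s : I => 1 - uval s)).
apply: (@comp_cont _ _ _ (@uval R) (fun r => 1 - r)); first exact: uval_continuous.
by move=> r; apply: cvgB; [exact: cvg_cst | exact: cvg_id].
Qed.

Lemma rev0 f : rev_fun f zero = x0.
Proof. by rewrite /rev_fun uval0 subr0 clamp1 loop1. Qed.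

Lemma rev1 f : rev_fun f one = x0.
Proof. by rewrite /rev_fun uval1 subrr clamp0 loop0. Qed.

Definition rev_loop f : loop := mk_path (@rev_continuous f) (rev0 f) (rev1 f).

Lemma rev_loopE f (s : I) : rev_loop f s = f (clamp (1 - uval s)). Proof. by []. Qed.

Lemma cst_continuous_loop : continuous (fun _ : I => x0).
Proof. by move=> s; exact: (@cst_continuous _ _ x0). Qed.

Definition const_loop : loop := mk_path cst_continuous_loop erefl erefl.

Lemma concat_homotopic f f' g g' :
  homotopic f f' -> homotopic g g' -> homotopic (concat f g) (concat f' g').
Proof.
move=> /homotopicE[H [cH H0 H1 Hx]] /homotopicE[K [cK K0 K1 Kx]].
apply: (@homotopicI _ _ (fun p => if p.1 <= 2^-1 then H (2 * p.1, p.2)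
  else K (2 * p.1 - 1, p.2))).
- apply: paste_continuous.
  + exact: fst_cont.
  + apply: (comp_cont _ cH); apply: pair_cont; last exact: snd_cont.
    by move=> p; apply: cvgM; [exact: cvg_cst | exact: fst_cont].
  + apply: (comp_cont _ cK); apply: pair_cont; last exact: snd_cont.
    move=> p; apply: cvgB; last exact: cvg_cst.
    by apply: cvgM; [exact: cvg_cst | exact: fst_cont].
  + by move=> [s u] /= ->; rewrite mulfV // subrr (Hx u).2 (Kx u).1.
- by move=> s; rewrite concatE /concat_fun /= H0 K0.
- by move=> s; rewrite concatE /concat_fun /= H1 K1.
- move=> u /=; rewrite invr_ge0 ler0n mulr0 (Hx _).1; split=> //.
  rewrite ifF; last by apply/negbTE; rewrite -ltNge; lra.
  by rewrite (_ : 2 * 1 - 1 = 1) ?(Kx _).2 //; lra.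
Qed.

Lemma rev_homotopic f g : homotopic f g -> homotopic (rev_loop f) (rev_loop g).
Proof.
move=> /homotopicE[H [cH H0 H1 Hx]].
apply: (@homotopicI _ _ (fun p => H (1 - p.1, p.2))).
- apply: (comp_cont _ cH); apply: pair_cont; last exact: snd_cont.
  by move=> p; apply: cvgB; [exact: cvg_cst | exact: fst_cont].
- by move=> s; rewrite rev_loopE /= H0.
- by move=> s; rewrite rev_loopE /= H1.
- by move=> u /=; rewrite subr0 subrr (Hx _).1 (Hx _).2.
Qed.

Let uval01 (s : I) : 0 <= uval s <= 1. Proof. by rewrite uval_ge0 uval_le1. Qed.

Let concat_lo f g (a : R) : 0 <= a <= 2^-1 -> concat f g (clamp a) = f (clamp (2 * a)).
Proof.
move=> /andP[a0 a1]; rewrite concatE /concat_fun clamp_id ?a1 // a0 /=; lra.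
Qed.

Let concat_hi f g (a : R) : 2^-1 < a <= 1 ->
  concat f g (clamp a) = g (clamp (2 * a - 1)).
Proof.
move=> /andP[a0 a1]; rewrite concatE /concat_fun clamp_id; last lra.
by rewrite leNgt a0.
Qed.

Let min_cont (phi psi : R -> R) : continuous phi -> continuous psi ->
  continuous (fun r => Num.min (phi r) (psi r)).
Proof. by move=> c d r; apply: continuous_min; [exact: c | exact: d]. Qed.

Let max_cont (phi psi : R -> R) : continuous phi -> continuous psi ->
  continuous (fun r => Num.max (phi r) (psi r)).
Proof. by move=> c d r; apply: continuous_max; [exact: c | exact: d]. Qed.

Let id_cont : continuous (fun r : R => r).
Proof. by move=> r; exact: cvg_id. Qed.

Let cst_cont (a : R) : continuous (fun _ : R => a).
Proof. by move=> r; exact: cvg_cst. Qed.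

Lemma concat_assoc f g h :
  homotopic (concat f (concat g h)) (concat (concat f g) h).
Proof.
pose phi (r : R) := Num.min (2 * r + 0) (Num.min (1 * r + 4^-1) (2^-1 * r + 2^-1)).
apply: (homotopic_reparam id_cont (_ : continuous phi) (f := concat f (concat g h))).
- by apply: min_cont; [|apply: min_cont]; exact: lin_cont.
- by move=> s; rewrite clampK.
- move=> s; rewrite -{1}(clampK s); have /andP[] := uval01 s.
  move: (uval s) => r r0 r1.
  case: (lerP r 4^-1) => r4.
    have -> : phi r = 2 * r.
      by rewrite /phi min_l addr0 // le_min; apply/andP; split; lra.
    rewrite concat_lo; last lra.
    by rewrite concat_lo ?concat_lo //; lra.
  case: (lerP r 2^-1) => r2.
    have -> : phi r = r + 4^-1.
      by rewrite /phi mul1r min_r min_l //; lra.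
    rewrite concat_lo; last lra.
    rewrite concat_hi; last lra.
    rewrite concat_hi; last lra.
    rewrite concat_lo; last lra.
    by congr (g (clamp _)); lra.
  have -> : phi r = 2^-1 * r + 2^-1.
    by rewrite /phi (@min_r _ _ (1 * r + _)) ?min_r //; lra.
  rewrite concat_hi; last lra.
  rewrite concat_hi; last lra.
  rewrite concat_hi; last lra.
  by congr (h (clamp _)); lra.
- rewrite /phi !mulr0 !add0r min_l // le_min; apply/andP; split; lra.
- by rewrite /phi (@min_r _ _ (1 * 1 + _)) ?min_r //; lra.
Qed.

Lemma concat_const_l f : homotopic (concat const_loop f) f.
Proof.
pose phi (r : R) := Num.max 0 (2 * r + -1).
apply: (homotopic_reparam (_ : continuous phi) id_cont (f := f)).
- by apply: max_cont; [exact: cst_cont | exact: lin_cont].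
- move=> s; rewrite -{1}(clampK s); have /andP[] := uval01 s.
  move: (uval s) => r r0 r1; case: (lerP r 2^-1) => r2.
    rewrite concat_lo; last lra.
    by rewrite /phi max_l ?clamp0 ?loop0 //; lra.
  rewrite concat_hi; last lra.
  by rewrite /phi max_r //; lra.
- by move=> s; rewrite clampK.
- by rewrite /phi max_l //; lra.
- by rewrite /phi max_r //; lra.
Qed.

Lemma concat_const_r f : homotopic (concat f const_loop) f.
Proof.
pose phi (r : R) := Num.min 1 (2 * r + 0).
apply: (homotopic_reparam (_ : continuous phi) id_cont (f := f)).
- by apply: min_cont; [exact: cst_cont | exact: lin_cont].
- move=> s; rewrite -{1}(clampK s); have /andP[] := uval01 s.
  move: (uval s) => r r0 r1; case: (lerP r 2^-1) => r2.
    rewrite concat_lo; last lra.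
    by rewrite /phi min_r ?addr0 //; lra.
  rewrite concat_hi; last lra.
  by rewrite /phi min_l ?clamp1 ?loop1 //; lra.
- by move=> s; rewrite clampK.
- by rewrite /phi min_r //; lra.
- by rewrite /phi min_l //; lra.
Qed.

Lemma concat_rev_r f : homotopic (concat f (rev_loop f)) const_loop.
Proof.
pose phi (r : R) := Num.min (2 * r + 0) (- 2 * r + 2).
apply: (homotopic_reparam (_ : continuous phi) (@cst_cont 0) (f := f)).
- by apply: min_cont; exact: lin_cont.
- move=> s; rewrite -{1}(clampK s); have /andP[] := uval01 s.
  move: (uval s) => r r0 r1; case: (lerP r 2^-1) => r2.
    rewrite concat_lo; last lra.
    by rewrite /phi min_l ?addr0 //; lra.
  rewrite concat_hi; last lra.
  rewrite rev_loopE clamp_id; last lra.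
  by rewrite /phi min_r; [congr (f (clamp _)); lra | lra].
- by move=> s; rewrite clamp0 loop0.
- by rewrite /phi min_l //; lra.
- by rewrite /phi min_r //; lra.
Qed.

Lemma concat_rev_l f : homotopic (concat (rev_loop f) f) const_loop.
Proof.
pose phi (r : R) := Num.max (- 2 * r + 1) (2 * r + -1).
apply: (homotopic_reparam (_ : continuous phi) (@cst_cont 1) (f := f)).
- by apply: max_cont; exact: lin_cont.
- move=> s; rewrite -{1}(clampK s); have /andP[] := uval01 s.
  move: (uval s) => r r0 r1; case: (lerP r 2^-1) => r2.
    rewrite concat_lo; last lra.
    rewrite rev_loopE clamp_id; last lra.
    by rewrite /phi max_l; [congr (f (clamp _)); lra | lra].
  rewrite concat_hi; last lra.
  by rewrite /phi max_r //; lra.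
- by move=> s; rewrite clamp1 loop1.
- by rewrite /phi max_l //; lra.
- by rewrite /phi max_r //; lra.
Qed.

Definition fundamental_group : Type := {eq_quot loop_equiv}.
HB.instance Definition _ := Choice.on fundamental_group.

Definition loop_class (f : loop) : fundamental_group := \pi_({eq_quot loop_equiv}) f.

Lemma loop_classE f g : loop_class f = loop_class g <-> homotopic f g.
Proof. by split=> [/eqmodP|h]; [|apply/eqmodP]. Qed.

Lemma loop_class_surj (a : fundamental_group) : exists f, a = loop_class f.
Proof. by exists (repr (a : {eq_quot loop_equiv})); rewrite /loop_class reprK. Qed.

Let rep (a : fundamental_group) : loop := repr (a : {eq_quot loop_equiv}).

Let repK f : homotopic (rep (loop_class f)) f.
Proof. by apply/loop_classE; rewrite /loop_class /rep reprK. Qed.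

Definition fg_mul (a b : fundamental_group) := loop_class (concat (rep a) (rep b)).
Definition fg_inv (a : fundamental_group) := loop_class (rev_loop (rep a)).

Lemma fg_mulE f g : fg_mul (loop_class f) (loop_class g) = loop_class (concat f g).
Proof. by apply/loop_classE; apply: concat_homotopic; exact: repK. Qed.

Lemma fg_invE f : fg_inv (loop_class f) = loop_class (rev_loop f).
Proof. by apply/loop_classE; apply: rev_homotopic; exact: repK. Qed.

Lemma fg_mulA : associative fg_mul.
Proof.
move=> a b c; have [f ->] := loop_class_surj a; have [g ->] := loop_class_surj b.
have [h ->] := loop_class_surj c; rewrite !fg_mulE; apply/loop_classE.
exact: concat_assoc.
Qed.

Lemma fg_mul1 : left_id (loop_class const_loop) fg_mul.
Proof.
move=> a; have [f ->] := loop_class_surj a; rewrite fg_mulE.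
by apply/loop_classE; exact: concat_const_l.
Qed.

Lemma fg_mulr1 : right_id (loop_class const_loop) fg_mul.
Proof.
move=> a; have [f ->] := loop_class_surj a; rewrite fg_mulE.
by apply/loop_classE; exact: concat_const_r.
Qed.

Lemma fg_mulV : left_inverse (loop_class const_loop) fg_inv fg_mul.
Proof.
move=> a; have [f ->] := loop_class_surj a; rewrite fg_invE fg_mulE.
by apply/loop_classE; exact: concat_rev_l.
Qed.

Lemma fg_mulrV : right_inverse (loop_class const_loop) fg_inv fg_mul.
Proof.
move=> a; have [f ->] := loop_class_surj a; rewrite fg_invE fg_mulE.
by apply/loop_classE; exact: concat_rev_r.
Qed.

HB.instance Definition _ := isGroup.Build fundamental_group
  fg_mulA fg_mul1 fg_mulr1 fg_mulV fg_mulrV.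

End FundamentalGroup.

Section DerivedSubgroup.
Variable G : groupType.

(* The commutator subgroup, as the smallest subgroup containing every
   commutator; [group_closed] is closure under 1 and division. *)
Definition derived : {pred G} := fun g =>
  `[< forall H : {pred G}, group_closed H ->
        (forall x y : G, commg x y \in H) -> g \in H >].

Lemma derivedP (g : G) :
  reflect (forall H : {pred G}, group_closed H ->
             (forall x y : G, commg x y \in H) -> g \in H) (g \in derived).
Proof. exact: asboolP. Qed.

Lemma derived_closed : group_closed derived.
Proof.
split=> [|x y]; first by apply/derivedP => H [].
move=> /derivedP dx /derivedP dy; apply/derivedP => H cH cR.
by apply: cH.2; [exact: dx | exact: dy].
Qed.

Lemma derived1 : 1%g \in derived. Proof. exact: derived_closed.1. Qed.

Lemma derivedM (x y : G) : x \in derived -> y \in derived -> (x * y)%g \in derived.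
Proof. exact: (group_closedM derived_closed). Qed.

Lemma derivedV (x : G) : x \in derived -> (x^-1)%g \in derived.
Proof. exact: (group_closedV derived_closed). Qed.

Lemma derivedR (x y : G) : commg x y \in derived.
Proof. by apply/derivedP. Qed.

Lemma derivedJ (x y : G) : x \in derived -> conjg x y \in derived.
Proof.
move=> dx; have -> : conjg x y = (x * commg x y)%g by rewrite /commg mulVKg.
by apply: derivedM => //; exact: derivedR.
Qed.

(* The same subgroup as a group in its own right. *)
Record commutator_subgroup : predArgType :=
  CommutatorSubgroup { csval : G; _ : csval \in derived }.

HB.instance Definition _ := [isSub for csval].
HB.instance Definition _ := [Choice of commutator_subgroup by <:].
HB.instance Definition _ :=
  SubChoice_isSubGroup.Build G derived commutator_subgroup derived_closed.

Definition cs_conj (t : G) (x : commutator_subgroup) : commutator_subgroup :=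
  CommutatorSubgroup (derivedJ t (valP x)).

End DerivedSubgroup.

Arguments derived : clear implicits.

Section Abelianization.
Variable G : groupType.

Definition ab_rel : rel G := fun x y => (x^-1 * y)%g \in derived G.

Lemma ab_rel_refl : reflexive ab_rel.
Proof. by move=> x; rewrite /ab_rel mulVg derived1. Qed.

Lemma ab_rel_sym : symmetric ab_rel.
Proof.
by move=> x y; rewrite /ab_rel; apply/idP/idP => /derivedV; rewrite invgM invgK.
Qed.

Lemma ab_rel_trans : transitive ab_rel.
Proof.
move=> y x z dxy dyz; rewrite /ab_rel.
have -> : (x^-1 * z = (x^-1 * y) * (y^-1 * z))%g by rewrite mulgA mulgK.
exact: derivedM.
Qed.

Definition ab_equiv := EquivRel _ ab_rel_refl ab_rel_sym ab_rel_trans.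

Definition abelianization := {eq_quot ab_equiv}.
HB.instance Definition _ := EqQuotient.on abelianization.
HB.instance Definition _ := Choice.on abelianization.

Definition to_ab (x : G) : abelianization := \pi_abelianization x.

Lemma to_abE (x y : G) : to_ab x = to_ab y <-> (x^-1 * y)%g \in derived G.
Proof. by split=> [/eqmodP|h]; [|apply/eqmodP]. Qed.

Lemma to_ab_surj (a : abelianization) : exists x, a = to_ab x.
Proof. by exists (repr a); rewrite /to_ab reprK. Qed.

Let to_abJ (x y : G) : to_ab (x * y)%g = to_ab (y * x)%g.
Proof.
apply/to_abE; have -> : ((x * y)^-1 * (y * x))%g = commg y x.
  by rewrite invgM /commg /conjg !mulgA.
exact: derivedR.
Qed.

Let to_abMl (x y z : G) : to_ab x = to_ab y -> to_ab (z * x)%g = to_ab (z * y)%g.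
Proof. by move/to_abE=> h; apply/to_abE; rewrite invgM -mulgA mulKg. Qed.

Definition ab_add (a b : abelianization) := to_ab (repr a * repr b)%g.
Definition ab_opp (a : abelianization) := to_ab (repr a)^-1%g.

Let repr_ab x : to_ab (repr (to_ab x)) = to_ab x.
Proof. by rewrite /to_ab reprK. Qed.

Lemma to_abM (x y : G) : to_ab (x * y)%g = ab_add (to_ab x) (to_ab y).
Proof.
rewrite /ab_add [RHS](to_abMl _ (repr_ab y)) [RHS]to_abJ.
by rewrite [RHS](to_abMl _ (repr_ab x)) to_abJ.
Qed.

Lemma to_abV (x : G) : to_ab x^-1%g = ab_opp (to_ab x).
Proof.
rewrite /ab_opp; apply/to_abE; rewrite invgK.
have /to_abE h := repr_ab x.
have := derivedJ (x^-1)%g h; rewrite /conjg invgK.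
by rewrite !mulgA mulgK.
Qed.

Lemma ab_addA : associative ab_add.
Proof.
move=> a b c; have [x ->] := to_ab_surj a; have [y ->] := to_ab_surj b.
have [z ->] := to_ab_surj c.
by rewrite -!to_abM mulgA.
Qed.

Lemma ab_addC : commutative ab_add.
Proof. by move=> a b; rewrite /ab_add to_abJ. Qed.

Lemma ab_add0 : left_id (to_ab 1%g) ab_add.
Proof. by move=> a; have [x ->] := to_ab_surj a; rewrite -to_abM mul1g. Qed.

Lemma ab_addN : left_inverse (to_ab 1%g) ab_opp ab_add.
Proof.
by move=> a; have [x ->] := to_ab_surj a; rewrite -to_abV -to_abM mulVg.
Qed.

HB.instance Definition _ :=
  GRing.isZmodule.Build abelianization ab_addA ab_addC ab_add0 ab_addN.

Lemma to_abD (x y : G) : to_ab (x * y)%g = to_ab x + to_ab y.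
Proof. exact: to_abM. Qed.

End Abelianization.

Local Notation "p %:F" := (@FracField.tofrac {poly int} p).

Lemma frac_subE (F : fieldType) (p q a b : F) : a != 0 -> b != 0 ->
  p / a - q / b = (p * b - q * a) / (a * b).
Proof. by move=> a0 b0; field; rewrite a0 b0. Qed.

Lemma frac_widen (F : fieldType) (p a b : F) : b != 0 ->
  p / a = (p * b) / (a * b).
Proof. by move=> b0; rewrite -mulf_div divff // mulr1. Qed.

(* Z[t, t^-1] is realised as the subring of the field of fractions of Z['X]
   consisting of the p / 'X^n. *)
Definition is_laurent : {pred {fraction {poly int}}} := fun x =>
  `[< exists (p : {poly int}) (n : nat), x = p%:F / ('X ^+ n)%:F >].

Lemma Xn_frac_neq0 n : (('X ^+ n : {poly int})%:F != 0).
Proof. by rewrite tofrac_eq0 expf_neq0 // polyX_eq0. Qed.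

Lemma is_laurent_subring : subring_closed is_laurent.
Proof.
split=> [|x y|x y].
- by apply/asboolP; exists 1, 0%N; rewrite expr0 divr1.
- move=> /asboolP[p [n ->]] /asboolP[q [m ->]]; apply/asboolP.
  exists (p * 'X^m - q * 'X^n), (n + m)%N.
  by rewrite exprD tofracB !tofracM frac_subE ?Xn_frac_neq0.
- move=> /asboolP[p [n ->]] /asboolP[q [m ->]]; apply/asboolP.
  by exists (p * q), (n + m)%N; rewrite exprD !tofracM mulf_div.
Qed.

Record laurent : predArgType :=
  Laurent { lval : {fraction {poly int}}; _ : lval \in is_laurent }.

HB.instance Definition _ := [isSub for lval].
HB.instance Definition _ := [Choice of laurent by <:].
HB.instance Definition _ :=
  GRing.SubChoice_isSubComNzRing.Build _ is_laurent laurent is_laurent_subring.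

Lemma lvalM (x y : laurent) : lval (x * y) = lval x * lval y.
Proof. exact: (rmorphM (val : laurent -> _)). Qed.

Lemma lvalD (x y : laurent) : lval (x + y) = lval x + lval y.
Proof. exact: (rmorphD (val : laurent -> _)). Qed.

Lemma lval1 : lval 1 = 1.
Proof. exact: (rmorph1 (val : laurent -> _)). Qed.

Lemma laurent_repr (x : laurent) :
  {u : {poly int} * nat | lval x = u.1%:F / ('X ^+ u.2)%:F}.
Proof.
apply: cid; case: x => x /= /asboolP[p [n ->]]; by exists (p, n).
Qed.

Definition lnum (x : laurent) : {poly int} := (sval (laurent_repr x)).1.
Definition lden (x : laurent) : nat := (sval (laurent_repr x)).2.

Lemma lvalE (x : laurent) : lval x = (lnum x)%:F / ('X ^+ lden x)%:F.
Proof. exact: (svalP (laurent_repr x)). Qed.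

(* The coefficient of t^i.  It does not depend on the chosen expression
   p / 'X^n, see [laurent_coefE]. *)
Definition laurent_coef (x : laurent) (i : int) : int :=
  if i + (lden x)%:Z is Posz j then (lnum x)`_j else 0.

Lemma laurent_cross (x : laurent) p n :
  lval x = p%:F / ('X ^+ n)%:F -> lnum x * 'X^n = p * 'X^(lden x).
Proof.
rewrite lvalE => /eqP; rewrite eqr_div ?Xn_frac_neq0 // -!tofracM tofrac_eq.
by move/eqP.
Qed.

Lemma laurent_coefE (x : laurent) p n i :
  lval x = p%:F / ('X ^+ n)%:F ->
  laurent_coef x i = if i + n%:Z is Posz j then p`_j else 0.
Proof.
move=> /laurent_cross E; rewrite /laurent_coef.
have C (m : nat) (q : {poly int}) (j : int) :
    (if j is Posz k then q`_k else 0)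
      = (if j + m%:Z is Posz k then (q * 'X^m)`_k else 0).
  case: j => k /=; first by rewrite coefMXn ltnNge leq_addl addnK.
  case: (ltnP k m) => km.
    have -> : Negz k + m%:Z = Posz (m - k.+1) by lia.
    by rewrite coefMXn ltn_subrL (leq_trans _ km).
  by have -> : Negz k + m%:Z = Negz (k - m) by lia.
rewrite (C n) (C (lden x) p) E.
by have -> : i + (lden x)%:Z + n%:Z = i + n%:Z + (lden x)%:Z by lia.
Qed.

Lemma laurent_coef_inj (x y : laurent) : laurent_coef x =1 laurent_coef y -> x = y.
Proof.
move=> E; apply: val_inj.
have X1 : lval x = (lnum x * 'X^(lden y))%:F / ('X^(lden x + lden y))%:F.
  by rewrite lvalE exprD !tofracM -frac_widen ?Xn_frac_neq0.
have Y1 : lval y = (lnum y * 'X^(lden x))%:F / ('X^(lden x + lden y))%:F.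
  by rewrite lvalE addnC exprD !tofracM -frac_widen ?Xn_frac_neq0.
have XY : lnum x * 'X^(lden y) = lnum y * 'X^(lden x).
  apply/polyP => i; have := E (i%:Z - (lden x + lden y)%N%:Z).
  by rewrite (laurent_coefE _ X1) (laurent_coefE _ Y1) subrK.
have xy : lval x = lval y by rewrite X1 XY -Y1.
exact: xy.
Qed.

Section LaurentAction.
Variables (V : zmodType) (s s' : {additive V -> V}).
Hypothesis (sK : cancel s s') (s'K : cancel s' s).

Implicit Types (p q : {poly int}) (u v : V).

(* For an additive automorphism s of V with inverse s', a Laurent polynomial
   \sum_i c_i t^i acts as v |-> \sum_i c_i s^i(v). *)
Definition poly_act p v : V :=
  \sum_(i < size p) iter i s v *~ p`_i.
Lemma poly_actE n p v : (size p <= n)%N ->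
  poly_act p v = \sum_(i < n) iter i s v *~ p`_i.
Proof.
move=> pn; rewrite /poly_act (big_ord_widen n (fun i => iter i s v *~ p`_i)) //.
rewrite [RHS](bigID (fun i : 'I_n => (i < size p)%N)) /=.
rewrite [X in _ = _ + X]big1 ?addr0 // => i; rewrite -leqNgt => h.
by rewrite nth_default.
Qed.

Lemma poly_actDl p q v : poly_act (p + q) v = poly_act p v + poly_act q v.
Proof.
pose n := maxn (size p) (size q).
rewrite (@poly_actE n (p + q)) ?size_polyD // (@poly_actE n p) ?leq_maxl //.
rewrite (@poly_actE n q) ?leq_maxr // -big_split; apply: eq_bigr => i _.
by rewrite coefD mulrzDr.
Qed.

Lemma iter_add i : {morph iter i s : u v / u + v}.
Proof. by elim: i => // i IH u v; rewrite /= IH raddfD. Qed.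

Lemma poly_actDr p : {morph poly_act p : u v / u + v}.
Proof.
move=> u v; rewrite /poly_act -big_split; apply: eq_bigr => i _.
by rewrite iter_add mulrzDl.
Qed.

Lemma poly_actC c v : poly_act c%:P v = v *~ c.
Proof. by rewrite (@poly_actE 1) ?size_polyC ?leq_b1 // big_ord1 coefC. Qed.

Lemma poly_actMX p v : poly_act (p * 'X) v = poly_act p (s v).
Proof.
rewrite (@poly_actE (size p).+1); last first.
  by rewrite (leq_trans (size_polyMleq _ _)) // size_polyX addn2.
rewrite big_ord_recl coefMX /= add0r; apply: eq_bigr => i _.
by rewrite coefMX /= -iterSr.
Qed.

Lemma poly_act_s p v : poly_act p (s v) = s (poly_act p v).
Proof.
rewrite raddf_sum; apply: eq_bigr => i _.
by rewrite raddfMz -iterS iterSr.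
Qed.

Lemma poly_act_Mz p v c : poly_act p (v *~ c) = poly_act p v *~ c.
Proof.
have a0 : poly_act p 0 = 0.
  by apply: (addrI (poly_act p 0)); rewrite -poly_actDr !addr0.
have aN u : poly_act p (- u) = - poly_act p u.
  by apply: (addrI (poly_act p u)); rewrite -poly_actDr !subrr.
have an u n : poly_act p (u *+ n) = poly_act p u *+ n.
  by elim: n => // n IH; rewrite !mulrS poly_actDr IH.
by case: c => n; rewrite ?NegzE ?mulrNz ?aN -!pmulrn an.
Qed.

Lemma poly_actM p q v : poly_act (p * q) v = poly_act p (poly_act q v).
Proof.
elim/poly_ind: p v => [|p c IH] v.
  by rewrite mul0r /poly_act size_poly0 !big_ord0.
rewrite mulrDl !poly_actDl mulrAC !poly_actMX IH.
congr (_ + _); first by rewrite poly_act_s.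
rewrite poly_actC [LHS](@poly_actE (size q)); last first.
  by rewrite mul_polyC size_scale_leq.
rewrite /poly_act mulrz_suml; apply: eq_bigr => i _.
by rewrite coefCM mulrC mulrzA.
Qed.

Lemma poly_actMXn n p v : poly_act (p * 'X^n) v = iter n s (poly_act p v).
Proof.
elim: n => [|n IH]; first by rewrite expr0 mulr1.
by rewrite exprSr mulrA poly_actMX poly_act_s IH.
Qed.

Lemma iterK n : cancel (iter n s) (iter n s').
Proof. by move=> v; elim: n => // n IH; rewrite iterSr /= sK IH. Qed.

Lemma poly_act_s' n p v :
  poly_act p (iter n s' v) = iter n s' (poly_act p v).
Proof.
elim: n => // n IH; rewrite /= -IH.
by apply: (can_inj sK); rewrite s'K -poly_act_s s'K.
Qed.

Lemma iter_add' n : {morph iter n s' : u v / u + v}.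
Proof.
by elim: n => // n IH u v /=; rewrite IH raddfD.
Qed.

Definition laurent_act (x : laurent) v : V := iter (lden x) s' (poly_act (lnum x) v).

Lemma laurent_actE (x : laurent) p n v : lval x = p%:F / ('X^n)%:F ->
  laurent_act x v = iter n s' (poly_act p v).
Proof.
move=> /laurent_cross /(congr1 (poly_act^~ v)); rewrite !poly_actMXn => E.
rewrite /laurent_act -(iterK n (poly_act (lnum x) v)) E -!iterD addnC iterD.
by rewrite iterK.
Qed.

Lemma laurent_actA x y v : laurent_act x (laurent_act y v) = laurent_act (x * y) v.
Proof.
have M : lval (x * y) = (lnum x * lnum y)%:F / ('X^(lden x + lden y))%:F.
  by rewrite lvalM (lvalE x) (lvalE y) mulf_div exprD !tofracM.
rewrite [RHS](laurent_actE _ M) poly_actM [LHS]/laurent_act [X in poly_act _ X]/laurent_act.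
by rewrite poly_act_s' iterD.
Qed.

Lemma laurent_act1 v : laurent_act 1 v = v.
Proof.
have E : lval 1 = 1%:F / ('X^0)%:F by rewrite lval1 expr0 tofrac1 divr1.
by rewrite (laurent_actE _ E) [LHS]poly_actC.
Qed.

Lemma laurent_actDr x : {morph laurent_act x : u v / u + v}.
Proof. by move=> u v; rewrite /laurent_act poly_actDr iter_add'. Qed.

Lemma laurent_actDl v : {morph laurent_act^~ v : x y / x + y}.
Proof.
move=> x y.
have X1 : lval x = (lnum x * 'X^(lden y))%:F / ('X^(lden x + lden y))%:F.
  by rewrite lvalE exprD !tofracM -frac_widen ?Xn_frac_neq0.
have Y1 : lval y = (lnum y * 'X^(lden x))%:F / ('X^(lden x + lden y))%:F.
  by rewrite lvalE addnC exprD !tofracM -frac_widen ?Xn_frac_neq0.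
rewrite [X in _ = X + _](laurent_actE _ X1) [X in _ = _ + X](laurent_actE _ Y1).
rewrite -iter_add' -poly_actDl.
by apply: laurent_actE; rewrite lvalD X1 Y1 -mulrDl -tofracD.
Qed.

End LaurentAction.

Section AlexanderModule.
Variable G : groupType.
Local Notation K := (commutator_subgroup G).

Lemma cs_conjM (u : G) : {morph @cs_conj G u : x y / (x * y)%g}.
Proof. by move=> x y; apply: val_inj; rewrite /= !(conjMg, valM). Qed.

Lemma cs_conjV (u : G) : {morph @cs_conj G u : x / (x^-1)%g}.
Proof.
move=> x; apply: (mulgI (cs_conj u x)); rewrite -cs_conjM !mulgV.
by apply: val_inj; rewrite /= conj1g.
Qed.

Lemma cs_conjR (u : G) : {morph @cs_conj G u : x y / commg x y}.
Proof. by move=> x y; rewrite /commg /conjg !(cs_conjM, cs_conjV). Qed.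

Lemma cs_conj1 (u : G) : cs_conj u 1%g = 1%g.
Proof. by apply: val_inj; rewrite /= conj1g. Qed.

Lemma cs_conj_derived (u : G) (x : K) :
  x \in derived K -> cs_conj u x \in derived K.
Proof.
move=> /derivedP dx; apply/derivedP => H cH HR.
apply: (dx [pred y | cs_conj u y \in H]) => [|y z]; last first.
  by rewrite inE cs_conjR.
split=> [|y z]; first by rewrite inE cs_conj1 cH.1.
by rewrite !inE cs_conjM cs_conjV; exact: cH.2.
Qed.

(* H_1(G'; Z) as a module over Z[t, t^-1], where the variable acts through
   conjugation by t : G. *)
Definition alexander_module (t : G) : Type := abelianization K.
HB.instance Definition _ (t : G) := GRing.Zmodule.on (alexander_module t).

Definition ab_conj (u : G) (a : abelianization K) : abelianization K :=
  to_ab (cs_conj u (repr a)).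

Lemma ab_conjE (u : G) (x : K) : ab_conj u (to_ab x) = to_ab (cs_conj u x).
Proof.
apply/to_abE; rewrite -cs_conjV -cs_conjM; apply: cs_conj_derived.
by apply/to_abE; rewrite /to_ab reprK.
Qed.

Lemma ab_conjB (u : G) : zmod_morphism (ab_conj u).
Proof.
have D : {morph ab_conj u : a b / a + b}.
  move=> a b; have [x ->] := to_ab_surj a; have [y ->] := to_ab_surj b.
  by rewrite -to_abD !ab_conjE cs_conjM to_abD.
have Z : ab_conj u 0 = 0 by apply: (addrI (ab_conj u 0)); rewrite -D !addr0.
move=> a b; rewrite D; congr (_ + _).
by apply: (addrI (ab_conj u b)); rewrite -D !subrr.
Qed.

HB.instance Definition _ (u : G) :=
  GRing.isZmodMorphism.Build _ _ (ab_conj u) (ab_conjB u).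

Lemma ab_conjK (u : G) : cancel (ab_conj u) (ab_conj u^-1%g).
Proof.
move=> a; have [x ->] := to_ab_surj a; rewrite [X in ab_conj _ X]ab_conjE ab_conjE; congr to_ab.
by apply: val_inj; rewrite /= conjgK.
Qed.

Lemma ab_conjVK (u : G) : cancel (ab_conj u^-1%g) (ab_conj u).
Proof. by move=> a; rewrite -{1}(invgK u) ab_conjK. Qed.

Variable t : G.

Definition alexander_scale (x : laurent) (a : alexander_module t) :
    alexander_module t :=
  laurent_act (ab_conj t) (ab_conj t^-1%g) x a.

Lemma alexander_scaleA x y a :
  alexander_scale x (alexander_scale y a) = alexander_scale (x * y) a.
Proof. exact: (laurent_actA (ab_conjK t) (ab_conjVK t)). Qed.

Lemma alexander_scale1 : left_id 1 alexander_scale.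
Proof. exact: (laurent_act1 (ab_conjK t)). Qed.

Lemma alexander_scaleDr : right_distributive alexander_scale +%R.
Proof. by move=> x a b; exact: (laurent_actDr). Qed.

Lemma alexander_scaleDl a : {morph alexander_scale^~ a : x y / x + y}.
Proof. exact: (laurent_actDl (ab_conjK t)). Qed.

HB.instance Definition _ := GRing.Zmodule_isLmodule.Build laurent
  (alexander_module t) alexander_scaleA alexander_scale1 alexander_scaleDr
  alexander_scaleDl.

Lemma alexander_scaleE (x : laurent) (p : {poly int}) (n : nat)
    (a : alexander_module t) :
  lval x = p%:F / ('X^n)%:F ->
  x *: a = iter n (ab_conj t^-1%g) (poly_act (ab_conj t) p a).
Proof. exact: (laurent_actE (ab_conjK t)). Qed.

End AlexanderModule.

Section AlexanderPolynomial.

Definition ring_dvd (L : comNzRingType) (a b : L) : Prop :=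
  exists c : L, b = c * a.

Definition is_hcf (L : comNzRingType) (S : set L) (d : L) : Prop :=
  (forall x, S x -> ring_dvd d x) /\
  (forall c, (forall x, S x -> ring_dvd c x) -> ring_dvd c d).

(* A is a presentation matrix of M with m generators and n relations: some
   generators e_0, ..., e_(m-1) of M have the span of the columns of A as their
   module of relations. *)
Definition is_presentation (L : comNzRingType) (M : lmodType L) m n
    (A : 'M[L]_(m, n)) : Prop :=
  exists e : 'I_m -> M,
    (forall x : M, exists v : 'cV[L]_m, x = \sum_i v i 0 *: e i) /\
    (forall v : 'cV[L]_m,
       \sum_i v i 0 *: e i = 0 <-> exists w : 'cV[L]_n, v = A *m w).

Definition maximal_minors (L : comNzRingType) m n (A : 'M[L]_(m, n)) : set L :=
  [set d | exists2 g : 'I_m -> 'I_n,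
     {homo g : i j / (i < j)%N} & d = \det (colsub g A)].

Definition maps_to_generator (G : groupType) (t : G) : Prop :=
  forall a : abelianization G, exists k : int, a = to_ab t *~ k.

(* A relation, because the Alexander polynomial is only defined up to units. *)
Definition is_alexander_polynomial (G : groupType) (Delta : laurent) : Prop :=
  exists (t : G) (m n : nat) (A : 'M[laurent]_(m, n)),
    [/\ maps_to_generator t, (m <= n)%N,
        is_presentation (alexander_module t) A &
        is_hcf (maximal_minors A) Delta].

Definition lowest_exponent (f : laurent) (a : int) : Prop :=
  laurent_coef f a != 0 /\ forall i : int, i < a -> laurent_coef f i = 0.

Definition highest_exponent (f : laurent) (b : int) : Prop :=
  laurent_coef f b != 0 /\ forall i : int, b < i -> laurent_coef f i = 0.

Definition non_constant (f : laurent) : Prop :=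
  exists a b : int,
    [/\ lowest_exponent f a, highest_exponent f b & 0 < b - a].

Definition monic_at_both_ends (f : laurent) : Prop :=
  exists a b : int,
    [/\ lowest_exponent f a, highest_exponent f b,
        laurent_coef f a = 1 \/ laurent_coef f a = -1 &
        laurent_coef f b = 1 \/ laurent_coef f b = -1].

End AlexanderPolynomial.

(* H has index n in G: the r_i, i < n, represent every left coset exactly
   once. *)
Definition has_index (G : groupType) (H : {pred G}) (n : nat) : Prop :=
  exists r : 'I_n -> G, forall x : G, exists! i : 'I_n, ((r i)^-1 * x)%g \in H.

Section Knots.
Variable R : realType.

(* The norm on 'rV[R]_n is the sup norm, so this is the boundary of the cube
   [-1, 1]^(n+1), i.e. the standard piecewise linear n-sphere. *)
Definition pl_sphere (n : nat) : set 'rV[R]_n.+1 := [set x | `|x| = 1].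
Arguments pl_sphere : clear implicits.

Definition convex_hull n (V : seq 'rV[R]_n) : set 'rV[R]_n :=
  [set x | exists w : 'I_(size V) -> R,
     [/\ forall i, 0 <= w i, \sum_i w i = 1 & x = \sum_i w i *: V`_i]].

(* f is piecewise linear on P: P is a union of finitely many compact convex
   polytopes, on each of which f is affine. *)
Definition piecewise_linear m n (P : set 'rV[R]_m) (f : 'rV[R]_m -> 'rV[R]_n) :
    Prop :=
  exists D : seq (seq 'rV[R]_m),
    P = [set x | exists2 V, V \in D & convex_hull V x] /\
    forall V, V \in D -> exists (A : 'M[R]_(m, n)) (b : 'rV[R]_n),
      forall x, convex_hull V x -> f x = x *m A + b.

(* Only the restriction of [knot_map] to the circle is relevant.  An injective
   piecewise linear map of a compact polyhedron is an embedding. *)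
Record knot := Knot {
  knot_map : 'rV[R]_2 -> 'rV[R]_4;
  knot_pl : piecewise_linear (pl_sphere 1%N) knot_map;
  knot_in_sphere : knot_map @` pl_sphere 1%N `<=` pl_sphere 3%N;
  knot_injective : {in pl_sphere 1%N &, injective knot_map}
}.

Definition knot_complement (k : knot) : set 'rV[R]_4 :=
  pl_sphere 3%N `\` knot_map k @` pl_sphere 1%N.

(* [x : knot_complement k] carries the subspace topology. *)
Definition knot_group (k : knot) (x : knot_complement k) : groupType :=
  fundamental_group R x.

End Knots.

Arguments pl_sphere {R} n.

(* Main.v *)
(** Let z be a root of f in a number field F.  Every maximal minor of the
presentation matrix A is divisible by f, so it vanishes at t = z and some
nonzero row w over F satisfies w A(z) = 0; this w is a nonzero homomorphism
from G'/G'' to F, with image spanned by the w_i z^j, j in Z.  Since f is monic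
at both ends, the powers z^j satisfy a linear recurrence over Z that can be
solved in both directions, so the image already lies in the span of finitely
many w_i z^j.  A coordinate of F over Q, times a common denominator, therefore
maps G'/G'' nontrivially to Z; dividing by the generator of the image makes it
onto, and the preimage of nZ has index n. *)
Require Import Defs.
From HB Require Import structures.
From mathcomp Require Import all_boot all_order all_algebra all_field.
From mathcomp Require Import all_classical all_reals all_analysis.
From mathcomp Require Import fraction zify.

Set Implicit Arguments.
Unset Strict Implicit.
Unset Printing Implicit Defensive.

Import Order.TTheory GRing.Theory Num.Theory.
Local Open Scope ring_scope.

(** * Nonzero maximal minors of a matrix of full row rank *)

Lemma enum_val_homo n (S : {set 'I_n}) :
  {homo (@enum_val _ (mem S)) : i j / (i < j)%N}.
Proof.
move=> i j ij; have x0 := enum_val i.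
have so : sorted (relpre val ltn) (enum S).
  rewrite /enum_mem; apply: sorted_filter => [y x z|]; first exact: ltn_trans.
  by rewrite -enumT -sorted_map val_enum_ord iota_ltn_sorted.
rewrite !(enum_val_nth x0); apply: (sorted_ltn_nth _ x0 so) => //.
- by move=> y x z; exact: ltn_trans.
- by rewrite inE -cardE ltn_ord.
- by rewrite inE -cardE ltn_ord.
Qed.

Lemma row_free_maximal_minor (F : fieldType) m n (A : 'M[F]_(m, n)) :
  row_free A -> exists2 d, maximal_minors A d & d != 0.
Proof.
rewrite -row_leq_rank -mxrank_tr => fA.
have {}fA : row_full A^T by rewrite -col_leq_rank.
(* [f] picks [m] independent rows of [A^T] without control of their order; listing the set [S] by
   [enum_val] gives the increasing selection that [maximal_minors] demands. *)
pose f := fullrankfun fA; pose S := f @: 'I_m.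
have cS : m = #|S| by rewrite card_imset ?card_ord //; exact: fullrankfun_inj.
pose g i : 'I_n := enum_val (cast_ord cS i).
have full : row_full (rowsub g A^T).
  rewrite -sub1mx; have := fullrowsub_full fA.
  rewrite -sub1mx => /submx_trans; apply.
  apply/row_subP => i; have Si : f i \in S by exact: imset_f.
  pose j := cast_ord (esym cS) (enum_rank_in Si (f i)).
  have -> : row i (rowsub f A^T) = row j (rowsub g A^T).
    by apply/rowP => l; rewrite !mxE /g cast_ordKV enum_rankK_in.
  exact: row_sub.
exists (\det (colsub g A)).
  exists g => // i j ij; exact: enum_val_homo.
by rewrite -det_tr trmx_mxsub -unitfE -[_ \is a _]/(_ \in unitmx) -row_full_unit.
Qed.

(** * Evaluation of Laurent polynomials at a nonzero element of a field *)

Section Evaluation.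
Variables (F : fieldType) (z : F).

Definition poly_ev (p : {poly int}) : F := (map_poly intr p).[z].

Lemma poly_evD p q : poly_ev (p + q) = poly_ev p + poly_ev q.
Proof. by rewrite /poly_ev rmorphD hornerD. Qed.

Lemma poly_evN p : poly_ev (- p) = - poly_ev p.
Proof. by rewrite /poly_ev rmorphN hornerN. Qed.

Lemma poly_evM p q : poly_ev (p * q) = poly_ev p * poly_ev q.
Proof. by rewrite /poly_ev rmorphM hornerM. Qed.

Lemma poly_evXn n : poly_ev 'X^n = z ^+ n.
Proof. by rewrite /poly_ev map_polyXn hornerXn. Qed.

Lemma poly_ev1 : poly_ev 1 = 1.
Proof. by rewrite /poly_ev rmorph1 hornerC. Qed.

Lemma poly_evE n (p : {poly int}) : (size p <= n)%N ->
  poly_ev p = \sum_(i < n) (p`_i)%:~R * z ^+ i.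
Proof.
move=> pn; rewrite /poly_ev (@horner_coef_wide _ n) ?(leq_trans (size_poly _ _)) //.
by apply: eq_bigr => i _; rewrite coef_map.
Qed.

(** The proof of [z != 0] is an argument so that [laurent_ev z0] can carry the ring morphism
    instance. *)
Definition laurent_ev of z != 0 := fun x : laurent =>
  poly_ev (lnum x) / z ^+ lden x.

Hypothesis z0 : z != 0.

Lemma laurent_evE (x : laurent) p n :
  lval x = (FracField.tofrac p) / (FracField.tofrac 'X^n) ->
  laurent_ev z0 x = poly_ev p / z ^+ n.
Proof.
move=> /laurent_cross /(congr1 poly_ev); rewrite !poly_evM !poly_evXn => E.
by apply/eqP; rewrite /laurent_ev eqr_div ?expf_neq0 // E.
Qed.

Lemma laurent_ev_zmod : zmod_morphism (laurent_ev z0).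
Proof.
move=> x y; rewrite (@laurent_evE _ (lnum x * 'X^(lden y) - lnum y * 'X^(lden x))
  (lden x + lden y)); last first.
  have -> : lval (x - y) = lval x - lval y by exact: (rmorphB (val : laurent -> _)).
  rewrite lvalE [X in _ - X]lvalE.
  by rewrite frac_subE ?Xn_frac_neq0 // exprD tofracB !tofracM.
rewrite poly_evD poly_evN !poly_evM !poly_evXn exprD.
by rewrite -frac_subE ?expf_neq0.
Qed.

Lemma laurent_ev_monoid : monoid_morphism (laurent_ev z0).
Proof.
split.
  by rewrite (@laurent_evE _ 1 0) ?poly_ev1 ?expr0 ?divr1 //.
move=> x y; rewrite (@laurent_evE _ (lnum x * lnum y) (lden x + lden y)).
  by rewrite poly_evM exprD -mulf_div.
by rewrite lvalM lvalE [X in _ * X]lvalE exprD !tofracM mulf_div.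
Qed.

HB.instance Definition _ := GRing.isZmodMorphism.Build laurent F
  (laurent_ev z0) laurent_ev_zmod.
HB.instance Definition _ := GRing.isMonoidMorphism.Build laurent F
  (laurent_ev z0) laurent_ev_monoid.

End Evaluation.

(** A root in [algC] generates a number field, and the embedding back into [algC] is injective.
    Finite degree over [rat] will supply rational coordinates. *)
Lemma number_field_root (q : {poly int}) : (1 < size q)%N ->
  exists (L : fieldExtType rat) (z : L), poly_ev z q = 0.
Proof.
move=> q1; have : size (map_poly intr q : {poly algC}) != 1%N.
  by rewrite size_map_poly_id0 ?gtn_eqF // intr_eq0 lead_coef_eq0 -size_poly_gt0 ltnW.
move=> /closed_rootP[a ra].
have [L [LC [s Es _]]] := num_field_exists [:: a].
case: s Es => [|z [|? ?]] [] // Ea.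
exists L, z; apply: (fmorph_inj LC); rewrite rmorph0 -(rootP ra).
rewrite /poly_ev -horner_map -map_poly_comp /= -Ea; congr (_.[_]).
by apply: eq_map_poly => c /=; rewrite rmorph_int.
Qed.

(* The row w is a linear form on L^m that kills the relations, so it descends
   to M. *)
Lemma presentation_morph (L F : comNzRingType) (M : lmodType L) m n
    (A : 'M[L]_(m, n)) (ev : {rmorphism L -> F}) (w : 'rV[F]_m) :
  is_presentation M A -> w *m map_mx ev A = 0 ->
  exists phi : M -> F, {morph phi : a b / a + b} /\
    (forall v : 'cV[L]_m, exists a, phi a = (w *m map_mx ev v) 0 0) /\
    (forall a, exists v : 'cV[L]_m, phi a = (w *m map_mx ev v) 0 0).
Proof.
move=> [e [gen rel]] wA.
pose c a : 'cV[L]_m := sval (cid (gen a)).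
have cE a : a = \sum_i c a i 0 *: e i by rewrite /c; case: cid.
pose psi (v : 'cV[L]_m) : F := (w *m map_mx ev v) 0 0.
have psiD u v : psi (u + v) = psi u + psi v.
  by rewrite /psi map_mxD mulmxDr mxE.
have psiN v : psi (- v) = - psi v by rewrite /psi map_mxN mulmxN mxE.
(* Two coordinate vectors of one element differ by a relation [A *m x], which [w] kills; so [psi]
   does not depend on the choice made in [c]. *)
have psi_rel (u v : 'cV[L]_m) : \sum_i u i 0 *: e i = \sum_i v i 0 *: e i -> psi u = psi v.
  move=> uv; apply/eqP; rewrite -subr_eq0 -psiN -psiD; apply/eqP.
  have /rel[x ->] : \sum_i (u - v) i 0 *: e i = 0.
    under eq_bigr do rewrite !mxE scalerBl.
    by rewrite sumrB uv subrr.
  by rewrite /psi map_mxM mulmxA wA mul0mx mxE.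
exists (fun a => psi (c a)); split; [|split].
- move=> a b /=; rewrite -psiD; apply: psi_rel; rewrite -cE.
  under eq_bigr do rewrite mxE scalerDl.
  by rewrite big_split /= -!cE.
- by move=> v; exists (\sum_i v i 0 *: e i); apply: psi_rel; rewrite -cE.
- by move=> a; exists (c a).
Qed.

(** * Homomorphisms to the integers and subgroups of finite index *)

Section Surjectivity.
Variables (K : groupType) (phi : K -> int).
Hypothesis phiM : {morph phi : a b / (a * b)%g >-> a + b}.

Lemma int_morph1 : phi 1%g = 0.
Proof. by apply: (addrI (phi 1%g)); rewrite -phiM mulg1 addr0. Qed.

Lemma int_morphV a : phi (a^-1)%g = - phi a.
Proof. by apply: (addrI (phi a)); rewrite -phiM mulgV int_morph1 subrr. Qed.

Lemma int_morphX a n : phi (a ^+ n)%g = phi a *+ n.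
Proof. by elim: n => [|n IH]; rewrite ?expg0 ?int_morph1 // expgS phiM IH mulrS. Qed.

Lemma int_morphXz a (k : int) : exists b, phi b = k * phi a.
Proof.
case: k => n; first by exists (a ^+ n)%g; rewrite int_morphX -mulr_natl natz.
exists ((a ^+ n.+1)^-1)%g.
by rewrite int_morphV int_morphX NegzE mulNr -mulr_natl natz.
Qed.

Lemma int_morph_surj a : phi a != 0 -> exists psi : K -> int,
  {morph psi : a b / (a * b)%g >-> a + b} /\ (forall k, exists b, psi b = k).
Proof.
move=> a0.
(* The form [n.+1] restricts the search to positive values, so [ex_minn] yields the least positive
   one. *)
have pos : exists n, `[< exists b, phi b = n.+1%:Z >].
  have [b Eb] : exists b, phi b = `|phi a|%:Z.
    rewrite abszE; case: (lerP 0 (phi a)) => h.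
      by exists a; rewrite ger0_norm.
    by exists (a^-1)%g; rewrite int_morphV ltr0_norm.
  exists `|phi a|%N.-1; apply/asboolP; exists b; rewrite Eb prednK //.
  by rewrite absz_gt0.
pose g := (ex_minn pos).+1.
have [b gE gmin] : exists2 b, phi b = g%:Z & forall c n, phi c = n.+1%:Z -> (g <= n.+1)%N.
  rewrite /g; case: ex_minnP => n /asboolP[b Eb] min; exists b => // c k Ek.
  by rewrite ltnS min //; apply/asboolP; exists c.
(* Multiplying [c] by a suitable [d] changes its value to the remainder of [phi c] modulo [g]; a
   positive remainder would contradict the minimality of [g]. *)
have dv c : (g%:Z %| phi c)%Z.
  apply/dvdz_mod0P; have [d Ed] := int_morphXz b (- (phi c %/ g)%Z).
  have := phiM c d; rewrite Ed gE {1}(divz_eq (phi c) g) mulNr addrAC subrr add0r.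
  have := modz_ge0 (phi c) (isT : g%:Z != 0).
  have := ltz_pmod (phi c) (isT : 0 < g%:Z).
  case: (phi c %% g)%Z => // -[|k] // kg _ /gmin; lia.
exists (fun c => (phi c %/ g)%Z); split=> [c d|k]; first by rewrite phiM divzDl.
by have [d Ed] := int_morphXz b k; exists d; rewrite Ed gE mulzK.
Qed.

End Surjectivity.

Lemma int_morph_index (K : groupType) (phi : K -> int) n :
  {morph phi : a b / (a * b)%g >-> a + b} -> (forall k, exists a, phi a = k) ->
  (0 < n)%N -> exists H : {pred K}, group_closed H /\ has_index H n.
Proof.
move=> phiM phis n0; pose H : {pred K} := fun a => (n%:Z %| phi a)%Z.
have HE a : (a \in H) = (n%:Z %| phi a)%Z by [].
exists H; split.
  split=> [|a b]; first by rewrite HE int_morph1.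
  by rewrite !HE phiM int_morphV // => na nb; rewrite rpredB.
(* The representatives take the values 0, ..., n - 1, so the coset of [a] is read off from [phi a]
   modulo [n]. *)
exists (fun i : 'I_n => sval (cid (phis i%:Z))) => a.
have E (i : 'I_n) : phi ((sval (cid (phis i%:Z)))^-1 * a)%g = phi a - i%:Z.
  by rewrite phiM int_morphV // addrC (svalP (cid (phis i%:Z))).
have rn : (`|(phi a %% n)%Z| < n)%N by have := ltz_pmod (phi a) (n0 : 0 < n%:Z); lia.
exists (Ordinal rn); split=> [|i]; rewrite HE E /=.
  by rewrite gez0_abs ?modz_ge0 -?lt0n // {1}(divz_eq (phi a) n) addrK dvdz_mull.
rewrite -eqz_mod_dvd => /eqP ai; apply: val_inj => /=.
by rewrite ai modz_nat modn_small.
Qed.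

(** * Integrality along a recurrence solvable in both directions *)

Section IntegralRecurrence.
Variables (F : fieldType) (z : F) (lam : {additive F -> rat}).
Variables (q : {poly int}) (d : nat).
Hypotheses (sq : size q = d.+2) (q0 : q`_0 \is a GRing.unit)
  (qd : q`_d.+1 \is a GRing.unit) (qz : poly_ev z q = 0).

(** At 0 the polynomial takes the value of its constant coefficient, which remains a unit in [F]. *)
Lemma root_unit_coef0_neq0 : z != 0.
Proof.
apply: contraTneq (rmorph_unit (intr : int -> F) q0) => z0.
by move: qz; rewrite z0 /poly_ev horner_coef0 coef_map /= => ->; rewrite unitr0.
Qed.

Hypothesis z0 : z != 0.

Lemma int_mulrz_unit (r : rat) (k : int) :
  k \is a GRing.unit -> r *~ k \is a Num.int -> r \is a Num.int.
Proof.
move=> uk rk; rewrite -[r]mulr1z -(mulrV uk) mulrzA.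
by rewrite -mulrzr rpredM // intr_int.
Qed.

(** Apply [lam] to [u * q(z) = 0]; additivity lets the integer coefficients out. *)
Lemma recurrence u : \sum_(i < d.+2) lam (u * z ^+ i) *~ q`_i = 0.
Proof.
transitivity (lam (u * poly_ev z q)); last by rewrite qz mulr0 raddf0.
rewrite (@poly_evE _ _ d.+2) ?sq // mulr_sumr raddf_sum; apply: eq_bigr => i _.
by rewrite mulrCA mulrzl raddfMz.
Qed.

(** The recurrence has order [d.+1], so a window of [d.+1] consecutive values determines all the
    others. *)
Definition integral_window u := forall j, (j <= d)%N -> lam (u * z ^+ j) \is a Num.int.

(* The leading coefficient of q is a unit, so the recurrence can be solved
   forwards. *)
Lemma integral_windowM u : integral_window u -> integral_window (u * z).
Proof.
move=> Pu j; rewrite leq_eqVlt => /orP[/eqP ->|jd]; rewrite -mulrA -exprS; last exact: Pu.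
apply: (int_mulrz_unit qd).
have /eqP := recurrence u; rewrite big_ord_recr /= addrC addr_eq0 => /eqP ->.
rewrite rpredN; apply: rpred_sum => i _.
by rewrite -mulrzr rpredM ?intr_int // Pu // -ltnS.
Qed.

(* The constant coefficient of q is a unit, so the recurrence can be solved
   backwards. *)
Lemma integral_windowV u : integral_window u -> integral_window (u / z).
Proof.
move=> Pu [|j] jd; last by rewrite exprS mulrA divfK //; apply: Pu; exact: ltnW.
apply: (int_mulrz_unit q0).
have /eqP := recurrence (u / z); rewrite big_ord_recl addr_eq0 => /eqP ->.
rewrite rpredN; apply: rpred_sum => i _.
rewrite -mulrzr rpredM ?intr_int // lift0 exprS mulrA divfK //.
by apply: Pu; rewrite -ltnS.
Qed.

(** Shifting the window back and then forward reaches every power of [z], and [x] evaluates to an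
    integer combination of such powers. *)
Lemma integral_window_laurent u (x : laurent) :
  integral_window u -> lam (u * laurent_ev z0 x) \is a Num.int.
Proof.
move=> Pu; have {}Pu n : integral_window (u / z ^+ n).
  elim: n => [|n IH]; first by rewrite expr0 divr1.
  by rewrite exprSr invfM mulrA; exact: integral_windowV.
have {}Pu n i : integral_window (u / z ^+ n * z ^+ i).
  elim: i => [|i IH]; first by rewrite expr0 mulr1.
  by rewrite exprSr mulrA; exact: integral_windowM.
rewrite /laurent_ev mulrCA mulrC (poly_evE _ (leqnn _)) mulr_sumr raddf_sum.
apply: rpred_sum => i _; rewrite mulrCA mulrzl raddfMz -mulrzr rpredM ?intr_int //.
by have := Pu (lden x) i 0%N isT; rewrite expr0 mulr1.
Qed.

End IntegralRecurrence.

(** * From the Alexander polynomial to an integer-valued homomorphism *)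

Lemma common_denominator (I : finType) (r : I -> rat) :
  exists2 D : nat, (D != 0)%N & forall i, r i *+ D \is a Num.int.
Proof.
exists (\prod_i `|denq (r i)|)%N.
  by rewrite -lt0n prodn_gt0 // => i; rewrite absz_gt0 denq_neq0.
move=> i; rewrite (bigD1 i) //= mulrnA rpredMn //.
by rewrite -mulr_natr natr_absz normr_denq -numqE intr_int.
Qed.

(* Up to a unit, f is a polynomial q with unit constant and leading
   coefficients. *)
Lemma monic_at_both_ends_poly (f : laurent) :
  non_constant f -> monic_at_both_ends f ->
  exists (q : {poly int}) a d, [/\ lnum f = q * 'X^a, size q = d.+2,
    q`_0 \is a GRing.unit & q`_d.+1 \is a GRing.unit].
Proof.
move=> [a' [b' [la' hb' ab]]] [a [b [la hb ua ub]]].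
(* The two hypotheses provide their extreme exponents separately; these agree by uniqueness. *)
have ea : a' = a.
  by case: (ltgtP a' a) => // h; [have := la'.1; rewrite (la.2 _ h) eqxx
    | have := la.1; rewrite (la'.2 _ h) eqxx].
have eb : b' = b.
  by case: (ltgtP b' b) => // h; [have := hb.1; rewrite (hb'.2 _ h) eqxx
    | have := hb'.1; rewrite (hb.2 _ h) eqxx].
subst a' b'; set p := lnum f.
have cE (j : nat) : p`_j = laurent_coef f (j%:Z - (lden f)%:Z).
  by rewrite /laurent_coef subrK.
have supp i : laurent_coef f i != 0 -> exists j : nat, i = j%:Z - (lden f)%:Z.
  rewrite /laurent_coef; case e: (i + _) => [j|//] _.
  by exists j; rewrite -e addrK.
have [j ej] := supp _ la.1; have [k ek] := supp _ hb.1.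
have jk : (j < k)%N by lia.
have sp : size p = k.+1.
  apply/eqP; rewrite eqn_leq; apply/andP; split.
    by apply/leq_sizeP => l kl; rewrite cE hb.2 //; lia.
  by rewrite ltnNge; apply: contra hb.1 => h; rewrite ek -cE nth_default.
have unit_pm (c : int) : c = 1 \/ c = -1 -> c \is a GRing.unit by case=> ->.
(* The [j] lowest coefficients of [p] vanish. The quotient has size [k - j + 1], which is [d.+2]
   because [j < k]. *)
exists (drop_poly j p), j, (k - j).-1; split.
- rewrite -[LHS](poly_take_drop j) (_ : take_poly j p = 0) ?add0r //.
  apply/polyP => l; rewrite coef_take_poly coef0; case: ltnP => // lj.
  by rewrite cE la.2 //; lia.
- by rewrite size_drop_poly sp; lia.
- by rewrite coef_drop_poly add0n cE -ej; exact: unit_pm.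
- rewrite coef_drop_poly cE (_ : ((k - j).-1.+1 + j)%N = k); last lia.
  by rewrite -ek; exact: unit_pm.
Qed.

(** Were the rows of the evaluated matrix free, some maximal minor of it would be nonzero; but
    determinants commute with [ev], so that minor is the value of a multiple of [f]. *)
Lemma alexander_kernel (F : fieldType) (ev : {rmorphism laurent -> F}) m n
    (A : 'M[laurent]_(m, n)) (Delta f : laurent) :
  is_hcf (maximal_minors A) Delta -> ring_dvd f Delta -> ev f = 0 ->
  exists2 w : 'rV[F]_m, w != 0 & w *m map_mx ev A = 0.
Proof.
move=> [hD _] [c Dc] f0; suff : ~~ row_free (map_mx ev A).
  rewrite -kermx_eq0 => /rowV0Pn[w /sub_kermxP wA w0]; by exists w.
apply/negP => /row_free_maximal_minor[_ [g gh ->]]; apply/negP; rewrite negbK.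
have [|e Ee] := hD (\det (colsub g A)); first by exists g.
by rewrite -map_mxsub det_map_mx Ee Dc !rmorphM f0 !mulr0.
Qed.

Lemma alexander_int_morph (G : groupType) (Delta f : laurent) :
  is_alexander_polynomial G Delta -> ring_dvd f Delta -> non_constant f ->
  monic_at_both_ends f ->
  exists phi : commutator_subgroup G -> int,
    {morph phi : a b / (a * b)%g >-> a + b} /\ exists a, phi a != 0.
Proof.
move=> [t [m [n [A [_ _ presA hD]]]]] fD nf mf.
have [q [s [d [fq sq q0 qd]]]] := monic_at_both_ends_poly nf mf.
have [|L [z qz]] := @number_field_root q; first by rewrite sq.
have zn := root_unit_coef0_neq0 q0 qz.
pose ev : {rmorphism laurent -> L} := laurent_ev zn.
have [|w wn wA] := @alexander_kernel _ ev _ _ _ _ f hD fD.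
  by rewrite /ev /= /laurent_ev fq poly_evM qz !mul0r.
have [i wi] : exists i, w 0 i != 0 by apply/rV0Pn.
(* A coordinate that does not vanish on [w 0 i] keeps the final homomorphism nonzero. *)
have [l li] : exists l, coord (vbasis {:L}) l (w 0 i) != 0.
  apply: contrapT => /forallNP H; case/eqP: wi.
  rewrite (coord_vbasis (memvf (w 0 i))) big1 // => l _.
  by have /negP := H l; rewrite negbK => /eqP ->; rewrite scale0r.
pose lam : {additive L -> rat} := coord (vbasis {:L}) l.
(* Scaling by [D] makes the starting window of every entry of [w] integral. *)
have [D Dn Dint] := common_denominator (fun ij : 'I_m * 'I_d.+1 =>
  lam (w 0 ij.1 * z ^+ ij.2)).
pose w' := D%:R *: w.
have w'A : w' *m map_mx ev A = 0 by rewrite -scalemxAl wA scaler0.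
have w'P j : integral_window z lam d (w' 0 j).
  move=> h hd; have := Dint (j, inord h).
  by rewrite /= inordK // mxE mulr_natl mulrnAl raddfMn.
have [phi [phiD [phis phiw]]] := presentation_morph presA w'A.
have phi_int a : lam (phi a) \is a Num.int.
  have [v ->] := phiw a; rewrite mxE raddf_sum; apply: rpred_sum => j _.
  rewrite [X in _ * X]mxE.
  exact: (integral_window_laurent sq q0 qd qz zn).
pose psi (a : commutator_subgroup G) : int := numq (lam (phi (to_ab a))).
have psiE a : (psi a)%:~R = lam (phi (to_ab a)) by rewrite /psi numqK.
exists psi; split=> [a b|].
  apply: (@intr_inj rat); rewrite rmorphD /= !psiE.
  by rewrite to_abD phiD raddfD.
(* On the [i]-th generator the value is [D] times the nonzero coordinate of [w 0 i]. *)
have [a Ea] := phis (delta_mx i 0); have [c Ec] := to_ab_surj a.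
exists c; rewrite -(intr_eq0 rat) psiE -Ec Ea map_delta_mx -colE !mxE mulr_natl.
by rewrite raddfMn mulrn_eq0 negb_or Dn.
Qed.

Theorem theorem3p1 (R : realType) (k : knot R) (x : knot_complement k)
    (Delta f : laurent) :
  let K : groupType := commutator_subgroup (knot_group x) in
  is_alexander_polynomial (knot_group x) Delta ->
  ring_dvd f Delta -> non_constant f -> monic_at_both_ends f ->
  (exists phi : K -> int,
     {morph phi : a b / (a * b)%g >-> a + b} /\
     (forall z : int, exists a : K, phi a = z)) /\
  (forall n : nat, (0 < n)%N ->
     exists H : {pred K}, group_closed H /\ has_index H n).
Proof.
move=> K hD fD nf mf.
have [phi [phiM [a a0]]] := alexander_int_morph hD fD nf mf.
have [psi [psiM psis]] := int_morph_surj phiM a0.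
by split=> [|n n0]; [exists psi | exact: int_morph_index psiM psis n0].
Qed.
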